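(* Let $G^{\varphi}=(G,U(\mathbb{Q}),\varphi)$ be a connected $U(\mathbb{Q})$-gain graph of order $n$ with maximum degree $\Delta\geq 2$. Then $$r(G^{\varphi})\geq\frac{n-2}{\Delta-1}.$$
   Context: $\mathbb{Q}$ denotes the skew field of real quaternions $q=x_0+x_1i+x_2j+x_3k$ ($x_0,\dots,x_3\in\mathbb{R}$), with conjugate $\bar q=x_0-x_1i-x_2j-x_3k$ and modulus $|q|=\sqrt{q\bar q}$; $U(\mathbb{Q})=\{q\in\mathbb{Q}:|q|=1\}$ is the multiplicative group of unit quaternions. A $U(\mathbb{Q})$-gain graph (quaternion unit gain graph) $G^{\varphi}=(G,U(\mathbb{Q}),\varphi)$ consists of a finite simple graph $G$ with vertices $v_1,\dots,v_n$ ($n\ge 1$ is the order) and a gain function $\varphi$ assigning to each oriented edge $e_{ij}$ (from $v_i$ to $v_j$, where $v_iv_j\in E(G)$; both orientations $e_{ij}$ and $e_{ji}$ of each edge are considered) an element $\varphi(e_{ij})=\varphi_{v_iv_j}\in U(\mathbb{Q})$ such that $\varphi(e_{ij})=\varphi(e_{ji})^{-1}=\overline{\varphi(e_{ji})}$. Its adjacency matrix $A(G^{\varphi})$ is the Hermitian $n\times n$ quaternion matrix with $(i,j)$ entry $\varphi(e_{ij})$ if $v_i$ and $v_j$ are adjacent and $0$ otherwise. The rank $r(G^{\varphi})$ is the row left rank of $A(G^{\varphi})$, i.e. the maximum number of rows of $A(G^{\varphi})$ that are left linearly independent (with respect to combinations $\sum_i q_i\alpha_i$ of rows $\alpha_i$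 with quaternion coefficients $q_i$ multiplying on the left). Connectedness and the maximum degree $\Delta$ of $G^{\varphi}$ are those of the underlying graph $G$. *)

(* Defs.v *)
From HB Require Import structures.
From mathcomp Require Import all_boot all_order all_algebra.
From mathcomp Require Import ring.
From mathcomp Require Import boolp reals.

Set Implicit Arguments.
Unset Strict Implicit.
Unset Printing Implicit Defensive.

Import Order.TTheory GRing.Theory Num.Theory.
Local Open Scope ring_scope.

(* [Quat a b c d] is a + b i + c j + d k *)
Record quaternion (R : Type) : Type :=
  Quat { qre : R; qi : R; qj : R; qk : R }.

Section QuaternionEncoding.
Variable R : Type.

Definition quat_to_prod (x : quaternion R) : R * R * (R * R) :=
  ((qre x, qi x), (qj x, qk x)).
Definition quat_of_prod (p : R * R * (R * R)) : quaternion R :=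
  Quat p.1.1 p.1.2 p.2.1 p.2.2.

Lemma quat_to_prodK : cancel quat_to_prod quat_of_prod.
Proof. by case. Qed.
End QuaternionEncoding.

HB.instance Definition _ (R : eqType) :=
  Equality.copy (quaternion R) (can_type (@quat_to_prodK R)).
HB.instance Definition _ (R : choiceType) :=
  Choice.copy (quaternion R) (can_type (@quat_to_prodK R)).

Section QuaternionRing.
Variable R : realType.
Local Notation Q := (quaternion R).
Implicit Types x y z : Q.

Definition qadd x y : Q :=
  Quat (qre x + qre y) (qi x + qi y) (qj x + qj y) (qk x + qk y).
Definition qopp x : Q := Quat (- qre x) (- qi x) (- qj x) (- qk x).

Lemma qaddA : associative qadd.
Proof. by case=> ????[????][????]; rewrite /qadd /= !addrA. Qed.
Lemma qaddC : commutative qadd.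
Proof.
by case=> a b c d [a' b' c' d']; rewrite /qadd /=; congr Quat; rewrite addrC.
Qed.
Lemma qadd0 : left_id (Quat 0 0 0 0) qadd.
Proof. by case=> ????; rewrite /qadd /= !add0r. Qed.
Lemma qaddN : left_inverse (Quat 0 0 0 0) qopp qadd.
Proof. by case=> ????; rewrite /qadd /= !addNr. Qed.

HB.instance Definition _ := GRing.isZmodule.Build Q qaddA qaddC qadd0 qaddN.

Definition qmul x y : Q :=
  Quat (qre x * qre y - qi x * qi y - qj x * qj y - qk x * qk y)
       (qre x * qi y + qi x * qre y + qj x * qk y - qk x * qj y)
       (qre x * qj y - qi x * qk y + qj x * qre y + qk x * qi y)
       (qre x * qk y + qi x * qj y - qj x * qi y + qk x * qre y).

Lemma qmulA : associative qmul.
Proof.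
by case=> a b c d [a' b' c' d'] [u v w t]; rewrite /qmul /=; congr Quat; ring.
Qed.
Lemma qmul1x : left_id (Quat 1 0 0 0) qmul.
Proof. by case=> a b c d; rewrite /qmul /=; congr Quat; ring. Qed.
Lemma qmulx1 : right_id (Quat 1 0 0 0) qmul.
Proof. by case=> a b c d; rewrite /qmul /=; congr Quat; ring. Qed.
Lemma qmulDl : left_distributive qmul +%R.
Proof.
case=> a b c d [a' b' c' d'] [u v w t].
by rewrite /GRing.add /= /qadd /qmul /=; congr Quat; ring.
Qed.
Lemma qmulDr : right_distributive qmul +%R.
Proof.
case=> a b c d [a' b' c' d'] [u v w t].
by rewrite /GRing.add /= /qadd /qmul /=; congr Quat; ring.
Qed.
Lemma qone_neq0 : Quat 1 0 0 0 != 0 :> Q.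
Proof. by apply/eqP => -[] /eqP; rewrite oner_eq0. Qed.

HB.instance Definition _ :=
  GRing.Zmodule_isNzRing.Build Q qmulA qmul1x qmulx1 qmulDl qmulDr qone_neq0.

Definition qreal (a : R) : Q := Quat a 0 0 0.

Definition qconj x : Q := Quat (qre x) (- qi x) (- qj x) (- qk x).

Definition qsqnorm x : R :=
  qre x ^+ 2 + qi x ^+ 2 + qj x ^+ 2 + qk x ^+ 2.

Lemma qsqnorm_ge0 x : 0 <= qsqnorm x.
Proof. by rewrite /qsqnorm !addr_ge0 ?sqr_ge0. Qed.

Lemma mulq_conj x : x * qconj x = qreal (qsqnorm x).
Proof.
case: x => a b c d.
by rewrite {1}/GRing.mul /= /qmul /qreal /qsqnorm /=; congr Quat; ring.
Qed.

Definition qmod x : R := Num.sqrt (qsqnorm x).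

Lemma qsqnorm_eq0 x : (qsqnorm x == 0) = (x == 0).
Proof.
apply/idP/eqP => [|->]; last by rewrite /qsqnorm /= expr0n /= !addr0.
case: x => a b c d; rewrite /qsqnorm /=.
rewrite !paddr_eq0 ?addr_ge0 ?sqr_ge0 // !sqrf_eq0.
by case/andP=> /andP[/andP[/eqP-> /eqP->] /eqP->] /eqP->.
Qed.

Definition qinv x : Q := qreal (qsqnorm x)^-1 * qconj x.

Lemma qmulVx : {in [pred x : Q | x != 0], left_inverse 1 qinv *%R}.
Proof.
move=> [a b c d]; rewrite inE -qsqnorm_eq0 => nz.
rewrite /qinv /qreal /qconj /GRing.mul /= /qmul /=; congr Quat; try by ring.
by rewrite -(mulVf nz) /qsqnorm /=; ring.
Qed.

Lemma qmulxV : {in [pred x : Q | x != 0], right_inverse 1 qinv *%R}.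
Proof.
move=> [a b c d]; rewrite inE -qsqnorm_eq0 => nz.
rewrite /qinv /qreal /qconj /GRing.mul /= /qmul /=; congr Quat; try by ring.
by rewrite -(mulVf nz) /qsqnorm /=; ring.
Qed.

Lemma qunitP x y : y * x = 1 /\ x * y = 1 -> x != 0.
Proof.
by move=> [yx _]; apply: contra_eq_neq yx => ->; rewrite mulr0 eq_sym oner_eq0.
Qed.

Lemma qinv_out : {in [predC [pred x : Q | x != 0]], qinv =1 id}.
Proof.
move=> x; rewrite !inE negbK => /eqP->.
by rewrite /qinv (_ : qconj 0 = 0) ?mulr0 // /qconj /= oppr0.
Qed.

HB.instance Definition _ :=
  GRing.NzRing_hasMulInverse.Build Q qmulVx qmulxV qunitP qinv_out.

Lemma invq_conj x : qmod x = 1 -> x^-1 = qconj x.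
Proof.
move=> x1; have s1 : qsqnorm x = 1.
  by rewrite -(sqr_sqrtr (qsqnorm_ge0 x)) -/(qmod x) x1 expr1n.
by rewrite [LHS]/(qinv x) /qinv s1 invr1 (_ : qreal 1 = 1) // mul1r.
Qed.

End QuaternionRing.

Section RowLeftRank.
Variables (D : nzRingType) (m n : nat) (A : 'M[D]_(m, n)).

Definition rows_left_independent (S : {set 'I_m}) : Prop :=
  forall q : 'I_m -> D,
    \sum_(i in S) q i *: row i A = 0 -> forall i, i \in S -> q i = 0.

Definition row_left_rank : nat :=
  \max_(S : {set 'I_m} | `[< rows_left_independent S >]) #|S|.
End RowLeftRank.

Record simple_graph (n : nat) := SimpleGraph {
  adj : rel 'I_n;
  adj_sym : symmetric adj;
  adj_irr : irreflexive adj
}.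

Definition connected_graph n (G : simple_graph n) : Prop :=
  forall u v : 'I_n, connect (adj G) u v.

Definition max_degree n (G : simple_graph n) : nat :=
  \max_(v : 'I_n) #|[set w | adj G v w]|.

(* The values of [gain] on non-adjacent pairs are irrelevant: they are
   unconstrained here and discarded by [adjacency_matrix]. By [invq_conj],
   the inverse in [gain_inv] is also the conjugate. *)
Record gain_graph (R : realType) (n : nat) := GainGraph {
  underlying :> simple_graph n;
  gain : 'I_n -> 'I_n -> quaternion R;
  gain_unit : forall u v, adj underlying u v -> qmod (gain u v) = 1;
  gain_inv : forall u v, adj underlying u v -> gain u v = (gain v u)^-1
}.

Definition adjacency_matrix (R : realType) n (G : gain_graph R n) :
    'M[quaternion R]_n :=
  \matrix_(u, v) (if adj G u v then gain G u v else 0).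

Definition gain_rank (R : realType) n (G : gain_graph R n) : nat :=
  row_left_rank (adjacency_matrix G).

(* Main.v *)
Require Import Defs.
From mathcomp Require Import all_boot all_order all_algebra.
From mathcomp Require Import boolp reals.

Set Implicit Arguments.
Unset Strict Implicit.
Unset Printing Implicit Defensive.

Import Order.TTheory GRing.Theory Num.Theory.
Local Open Scope ring_scope.

(** Grow a set [S] of vertices whose principal submatrix has independent rows
    and whose closed neighbourhood has at most [#|S| * (Delta - 1) + 2]
    vertices, starting from the two ends of an edge. If the closed
    neighbourhood misses a vertex, connectedness gives an edge [xw] with [x] in
    it and [w] outside. In the subgraph induced by [S], [x] and [w], the vertex
    [w] is pendant, so adding [x] and [w] keeps the rows independent; as [x]
    has a neighbour in [S], at most [2 * (Delta - 1)] new vertices are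
    dominated. A largest such [S] is therefore dominating, and its size is at
    most the rank. *)

Lemma qmod1_unit {R : realType} (a : quaternion R) :
  qmod a = 1 -> a \is a GRing.unit.
Proof.
(* The unit predicate on quaternions is by construction [x != 0], hence the trivial closing step. *)
move=> a1; have : a != 0; last by [].
rewrite -qsqnorm_eq0; apply: contra_eq_neq a1 => a0.
by rewrite /qmod a0 sqrtr0 eq_sym oner_eq0.
Qed.

Section PrincipalIndependence.
Variables (D : unitRingType) (n : nat).
Implicit Types (A : 'M[D]_n) (S : {set 'I_n}).

(** Stronger than independence of the full rows: only columns in [S] are tested. This makes the
    property stable under pendant extensions. *)
Definition principal_rows_independent A S : Prop :=
  forall q : 'I_n -> D,
    (forall j, j \in S -> \sum_(i in S) q i * A i j = 0) ->
    forall i, i \in S -> q i = 0.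

Lemma card_le_row_left_rank A S :
  principal_rows_independent A S -> (#|S| <= row_left_rank A)%N.
Proof.
move=> indS; apply: (@leq_bigmax_cond _ _ (fun S : {set 'I_n} => #|S|)).
apply/asboolP => q q0; apply: indS => j _.
move/matrixP/(_ ord0 j): q0; rewrite summxE mxE => q0; rewrite -[RHS]q0.
by apply: eq_bigr => i _; rewrite !mxE.
Qed.

(** In column [w] only row [x] contributes, so [q x = 0]. Row [w] vanishes on [S], so the columns in
    [S] then give [q = 0] on [S]. Column [x] is finally left with [q w * A w x]. *)
Lemma principal_rows_independent_pendant A S x w :
    x \notin S -> w \notin S -> x != w ->
    A x w \is a GRing.unit -> A w x \is a GRing.unit -> A w w = 0 ->
    (forall i, i \in S -> A i w = 0) -> (forall j, j \in S -> A w j = 0) ->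
  principal_rows_independent A S ->
  principal_rows_independent A (x |: (w |: S)).
Proof.
move=> xS wS xw Axw Awx Aww Sw wS0 indS q q0.
have xwS : x \notin w |: S by rewrite !inE negb_or xw.
have sumE j : \sum_(i in x |: (w |: S)) q i * A i j =
    q x * A x j + (q w * A w j + \sum_(i in S) q i * A i j).
  by rewrite big_setU1 // big_setU1.
have qx : q x = 0.
  have := q0 w; rewrite sumE !inE eqxx orbT => /(_ isT).
  rewrite Aww mulr0 add0r big1 ?addr0 => [|i iS]; last by rewrite Sw ?mulr0.
  by move=> qA; apply: (mulIr Axw); rewrite mul0r.
have qS i : i \in S -> q i = 0.
  apply: indS => j jS; have := q0 j; rewrite sumE !inE jS !orbT => /(_ isT).
  by rewrite qx mul0r add0r wS0 // mulr0 add0r.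
have qw : q w = 0.
  have := q0 x; rewrite sumE !inE eqxx => /(_ isT).
  rewrite qx mul0r add0r big1 ?addr0 => [|i iS]; last by rewrite qS ?mul0r.
  by move=> qA; apply: (mulIr Awx); rewrite mul0r.
by move=> i; rewrite !inE => /or3P[/eqP->|/eqP->|/qS].
Qed.

End PrincipalIndependence.

Section Graph.
Variables (n : nat) (G : simple_graph n).
Implicit Types S : {set 'I_n}.

Definition neighbours (v : 'I_n) : {set 'I_n} := [set w | adj G v w].

Definition closed_neighbourhood S : {set 'I_n} :=
  S :|: \bigcup_(v in S) neighbours v.

Lemma card_neighbours v : (#|neighbours v| <= max_degree G)%N.
Proof. exact: (@leq_bigmax _ (fun v => #|neighbours v|)). Qed.

Lemma card_neighboursD1 v w :
  adj G v w -> (#|neighbours v :\ w| <= (max_degree G).-1)%N.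
Proof.
move=> vw; have := card_neighbours v.
by rewrite (cardsD1 w) inE vw add1n; case: max_degree.
Qed.

Lemma notin_closed_neighbourhood S w v :
  w \notin closed_neighbourhood S -> v \in S -> adj G v w = false.
Proof.
rewrite !inE negb_or => /andP[_ /bigcupP wN] vS.
by apply/negP => vw; apply: wN; exists v; rewrite ?inE.
Qed.

Lemma connected_boundary_edge (B : {set 'I_n}) u :
    connected_graph G -> u \in B -> B != setT ->
  exists x w, [/\ x \in B, w \notin B & adj G x w].
Proof.
move=> conn uB BT; apply: contrapT => noedge; case/eqP: BT.
(* [-uB] replaces [true] by [u \in B]: the goal becomes that membership in [B] is constant along the
   path from [u] to [v]. *)
apply/setP => v; rewrite inE -uB; apply/esym.
apply: (@closed_connect _ (adj G)) (conn u v).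
apply: intro_closed => [|x w xw xB].
  by apply: sym_connect_sym; exact: adj_sym.
by apply: contrapT => /negP wB; apply: noedge; exists x, w.
Qed.

(** New vertices are neighbours of [x] or [w]. A neighbour [y] of [x] in [S], and [x] as a neighbour
    of [w], are already counted, so each contributes at most Delta - 1. The vertex [w] itself counts
    among the neighbours of [x]. *)
Lemma closed_neighbourhoodU2 S x w :
    x \in closed_neighbourhood S -> w \notin closed_neighbourhood S ->
    adj G x w ->
  (#|closed_neighbourhood (x |: (w |: S))| <=
     #|closed_neighbourhood S| + 2 * (max_degree G).-1)%N.
Proof.
move=> xN wN xw.
have wx : adj G w x by rewrite adj_sym.
have xS : x \notin S.
  by apply/negP => /(notin_closed_neighbourhood wN); rewrite xw.
have [y yS yx] : exists2 y, y \in S & adj G y x.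
  move: (xN); rewrite inE (negPf xS) => /bigcupP[y yS].
  by rewrite inE; exists y.
have sub : closed_neighbourhood (x |: (w |: S)) \subset
    closed_neighbourhood S :|: ((neighbours x :\ y) :|: (neighbours w :\ x)).
  have yN : y \in closed_neighbourhood S by rewrite inE yS.
  have wy : w != y by apply: contraNneq wN => ->.
  have old v z : v \in S -> adj G v z -> z \in closed_neighbourhood S.
    by move=> vS vz; rewrite inE; apply/orP; right;
       apply/bigcupP; exists v; rewrite ?inE.
  apply/subsetP => z /setUP[/setU1P[->|/setU1P[->|zS]]|/bigcupP[v]].
  - by rewrite inE xN.
  - by rewrite !(inE, xw, wy) !orbT.
  - by rewrite !inE zS.
  rewrite [z \in neighbours v]inE => /setU1P[->|/setU1P[->|vS]] vz.
  - have [->|zy] := eqVneq z y; first by rewrite inE yN.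
    by rewrite in_setU in_setU !in_setD1 zy [z \in neighbours x]inE vz !orbT.
  - have [->|zx] := eqVneq z x; first by rewrite inE xN.
    by rewrite in_setU in_setU !in_setD1 zx [z \in neighbours w]inE vz !orbT.
  - by rewrite inE (old v).
apply: leq_trans (subset_leq_card sub) _.
apply: leq_trans (leq_card_setU _ _) _; rewrite leq_add2l.
apply: leq_trans (leq_card_setU _ _) _; rewrite mul2n -addnn.
by apply: leq_add; apply: card_neighboursD1; rewrite // adj_sym.
Qed.

(** Each end is a neighbour of the other, so two open neighbourhoods suffice. The bound 2 Delta is
    written in the shape of the invariant for a set of size 2. *)
Lemma closed_neighbourhood_edge x w :
    adj G x w ->
  (#|closed_neighbourhood [set x; w]| <= 2 * (max_degree G).-1 + 2)%N.
Proof.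
move=> xw; have wx : adj G w x by rewrite adj_sym.
have sub : closed_neighbourhood [set x; w] \subset neighbours x :|: neighbours w.
  apply/subsetP => z /setUP[/set2P[->|->]|/bigcupP[v /set2P[->|->]]].
  - by rewrite !inE wx orbT.
  - by rewrite !inE xw.
  - by rewrite in_setU => ->.
  - by rewrite in_setU orbC => ->.
apply: leq_trans (subset_leq_card sub) _.
apply: leq_trans (leq_card_setU _ _) _.
rewrite -mulnSr mul2n -addnn.
by apply: leq_add; apply: leq_trans (card_neighbours _) (leqSpred _).
Qed.

End Graph.

Section GainGraph.
Variables (R : realType) (n : nat) (G : gain_graph R n).
Local Notation A := (adjacency_matrix G).

Lemma adjacency_matrix_unit u v : adj G u v -> A u v \is a GRing.unit.
Proof. by move=> uv; rewrite mxE uv; apply/qmod1_unit/gain_unit. Qed.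

Lemma adjacency_matrix_eq0 u v : adj G u v = false -> A u v = 0.
Proof. by rewrite mxE => ->. Qed.

Lemma adjacency_rows_independentU2 (S : {set 'I_n}) x w :
    w \notin closed_neighbourhood G S -> adj G x w ->
    principal_rows_independent A S ->
  principal_rows_independent A (x |: (w |: S)).
Proof.
move=> wN xw; have Sw := notin_closed_neighbourhood wN.
apply: principal_rows_independent_pendant => //.
- by apply/negP => /Sw; rewrite xw.
- by apply: contraNN wN => wS; rewrite inE wS.
- by apply: contraTneq xw => ->; rewrite adj_irr.
- exact: adjacency_matrix_unit.
- by apply: adjacency_matrix_unit; rewrite adj_sym.
- by rewrite adjacency_matrix_eq0 ?adj_irr.
- by move=> i /Sw; exact: adjacency_matrix_eq0.
- by move=> j /Sw; rewrite adj_sym; exact: adjacency_matrix_eq0.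
Qed.

(** Division-free form in the naturals; [.-1] is a true subtraction as the degree is positive. *)
Lemma order_le_gain_rank :
    connected_graph G -> (0 < max_degree G)%N ->
  (n <= gain_rank G * (max_degree G).-1 + 2)%N.
Proof.
move=> conn deg0.
(* Nonemptiness supplies the vertex from which connectedness leaves the closed neighbourhood. *)
pose P (S : {set 'I_n}) := [/\ principal_rows_independent A S, S != set0 &
  (#|closed_neighbourhood G S| <= #|S| * (max_degree G).-1 + 2)%N].
have [u [v uv]] : exists u v, adj G u v.
  apply: contrapT => noedge; move: deg0; rewrite lt0n => /eqP; apply.
  apply/eqP; rewrite -leqn0; apply/bigmax_leqP => u _.
  rewrite leqn0 cards_eq0; apply/eqP/setP => v; rewrite !inE.
  by apply/negP => uv; apply: noedge; exists u, v.
have P0 : `[< P [set u; v] >].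
  have uv_neq : u != v by apply: contraTneq uv => ->; rewrite adj_irr.
  apply/asboolP; split.
  (* The edge is seen as a pendant extension of the empty set, where independence is vacuous. *)
  - rewrite -[[set v]]setU0; apply: adjacency_rows_independentU2 => //.
      by rewrite /closed_neighbourhood big_set0 setU0 inE.
    by move=> q _ i; rewrite inE.
  - by apply/set0Pn; exists u; rewrite !inE eqxx.
  - by rewrite cards2 uv_neq closed_neighbourhood_edge.
case: (@arg_maxnP _ _ (fun S => `[< P S >]) (fun S => #|S|) P0) =>
  S /asboolP[ind nz cardN] maxS.
have [NT|NT] := eqVneq (closed_neighbourhood G S) setT.
  rewrite NT cardsT card_ord in cardN; apply: leq_trans cardN _.
  by rewrite leq_add2r leq_mul2r (card_le_row_left_rank ind) orbT.
have /set0Pn[s sS] := nz.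
have sN : s \in closed_neighbourhood G S by rewrite inE sS.
have [x [w [xN wN xw]]] := connected_boundary_edge conn sN NT.
have wS : w \notin S by apply: contraNN wN => wS; rewrite inE wS.
have xwS : x \notin w |: S.
  rewrite !inE negb_or; apply/andP; split.
    by apply: contraTneq xw => ->; rewrite adj_irr.
  by apply/negP => /(notin_closed_neighbourhood wN); rewrite xw.
have card_xwS : #|x |: (w |: S)| = (2 + #|S|)%N.
  by rewrite cardsU1 xwS cardsU1 wS.
suff /maxS : `[< P (x |: (w |: S)) >].
  by rewrite card_xwS add2n => /ltnW; rewrite ltnn.
apply/asboolP; split.
- exact: adjacency_rows_independentU2.
- by apply/set0Pn; exists x; rewrite !inE eqxx.
- apply: leq_trans (closed_neighbourhoodU2 xN wN xw) _.
  by rewrite card_xwS mulnDl addnC -addnA leq_add2l.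
Qed.

End GainGraph.

Theorem theorem4p2 (R : realType) (n : nat) (G : gain_graph R n)
    (n_ge1 : (1 <= n)%N)
    (G_connected : connected_graph G)
    (max_degree_ge2 : (2 <= max_degree G)%N) :
  (n%:R - 2) / ((max_degree G)%:R - 1) <= (gain_rank G)%:R :> R.
Proof.
have deg_gt0 : (0 < max_degree G)%N by exact: ltnW.
rewrite ler_pdivrMr; last by rewrite subr_gt0 ltr1n.
(* Reading the real 1 as a cast lets Delta - 1 become the cast of a predecessor, by [deg_gt0]. *)
rewrite lerBlDr -[X in _ - X]/(1%:R) -natrB // subn1 -natrM -natrD ler_nat.
exact: order_le_gain_rank.
Qed.
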